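(* Let $k:=\lfloor \epsilon N\rfloor$, for each $p\in[P]$ let $q_p$ be the $(k+1)$-th largest value (counted with multiplicity) amongst $\{-\mathbf{b}_p^\top\boldsymbol{\xi}_i\}_{i\in[N]}$, let $[N]_p:=\{i\in[N]: -\mathbf{b}_p^\top\boldsymbol{\xi}_i>q_p\}$, and let $M>0$ be a sufficiently large constant (see context). Then the mixed-integer program \begin{align*} \min_{\mathbf{z},\mathbf{r},t,\mathbf{x}}\quad & \mathbf{c}^\top\mathbf{x}\\ \text{s.t.}\quad & \mathbf{z}\in\{0,1\}^N,\ t\ge0,\ \mathbf{r}\in\mathbb{R}^N,\ \mathbf{r}\ge\mathbf{0},\ \mathbf{x}\in\mathcal{X},\\ & \epsilon\, t \geq \theta + \frac{1}{N}\sum_{i\in[N]} r_i,\\ & M(1-z_i)\geq t-r_i, \quad i\in[N],\\ & \sum_{i\in[N]} z_i\leq k,\\ & \frac{\mathbf{b}_p^\top \boldsymbol{\xi}_i+d_p-\mathbf{a}_p^\top\mathbf{x}}{\|\mathbf{b}_p\|_*}+\frac{-\mathbf{b}_p^\top\boldsymbol{\xi}_i-q_p}{\|\mathbf{b}_p\|_*}\, z_i\geq t-r_i, \quad i\in[N]_p,\ p\in[P],\\ & \frac{-q_p+d_p-\mathbf{a}_p^\top\mathbf{x}}{\|\mathbf{b}_p\|_*}\geq t,\quad p\in[P], \end{align*} is an exact reformulation of $\min\{\mathbf{c}^\top\mathbf{x}:\mathbf{x}\in\mathcal{X}_{\mathrm{DR}}(\mathcal{S})\}$; that is, $\mathcal{X}_{\mathrm{DR}}(\mathcal{S})$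 equals the set of $\mathbf{x}\in\mathcal{X}$ for which there exist $(\mathbf{z},\mathbf{r},t)$ such that $(\mathbf{z},\mathbf{r},t,\mathbf{x})$ satisfies all of the constraints of this mixed-integer program.
   Context: Notation: $[n]:=\{1,\dots,n\}$. Fix positive integers $K,L,N,P$, a compact set $\mathcal{X}\subset\mathbb{R}^L$, a cost vector $\mathbf{c}\in\mathbb{R}^L$, a norm $\|\cdot\|$ on $\mathbb{R}^K$ with dual norm $\|\cdot\|_*$, samples $\boldsymbol{\xi}_1,\dots,\boldsymbol{\xi}_N\in\mathbb{R}^K$, a risk tolerance $\epsilon\in(0,1)$ and a radius $\theta>0$. For $p\in[P]$ let $\mathbf{a}_p\in\mathbb{R}^L$, $\mathbf{b}_p\in\mathbb{R}^K\setminus\{\mathbf{0}\}$, $d_p\in\mathbb{R}$. For $\mathbf{x}\in\mathcal{X}$ the safety set is $$\mathcal{S}(\mathbf{x}):=\{\boldsymbol{\xi}\in\mathbb{R}^K:\ \mathbf{b}_p^\top\boldsymbol{\xi}+d_p-\mathbf{a}_p^\top\mathbf{x}>0,\ p\in[P]\}.$$ Let $\mathbb{P}_N$ be the empirical distribution on $\boldsymbol{\xi}_1,\dots,\boldsymbol{\xi}_N$ (mass $1/N$ on each sample). For distributions $\mathbb{P},\mathbb{P}'$ on $\mathbb{R}^K$, the 1-Wasserstein distance is $$d_W(\mathbb{P},\mathbb{P}'):=\inf_{\Pi}\{\mathbb{E}_{(\boldsymbol{\xi},\boldsymbol{\xi}')\sim\Pi}[\|\boldsymbol{\xi}-\boldsymbol{\xi}'\|]:\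 \Pi\text{ has marginal distributions }\mathbb{P},\mathbb{P}'\},$$ and the ambiguity set is $\mathcal{F}_N(\theta):=\{\mathbb{P}: d_W(\mathbb{P}_N,\mathbb{P})\le\theta\}$. The feasible region of the distributionally robust chance-constrained program is $$\mathcal{X}_{\mathrm{DR}}(\mathcal{S}):=\Big\{\mathbf{x}\in\mathcal{X}:\ \sup_{\mathbb{P}\in\mathcal{F}_N(\theta)}\mathbb{P}[\boldsymbol{\xi}\notin\mathcal{S}(\mathbf{x})]\le\epsilon\Big\}.$$ ''$M$ sufficiently large'' means: $M>0$ and $M\ge |\mathbf{b}_p^\top\boldsymbol{\xi}_i+d_p-\mathbf{a}_p^\top\mathbf{x}|/\|\mathbf{b}_p\|_*$ for all $\mathbf{x}\in\mathcal{X}$, $i\in[N]$, $p\in[P]$. *)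

(* Defs.v *)
From HB Require Import structures.
From mathcomp Require Import all_boot all_order all_algebra.
From mathcomp Require Import all_classical all_reals all_analysis.

Set Implicit Arguments.
Unset Strict Implicit.
Unset Printing Implicit Defensive.

Import Order.TTheory GRing.Theory Num.Theory.
Import numFieldNormedType.Exports.

Local Open Scope classical_set_scope.
Local Open Scope ring_scope.

Section vectors.
Context {R : realType} {n : nat}.
Implicit Types (u v : 'cV[R]_n) (nrm : 'cV[R]_n -> R).

Definition dot u v : R := (u^T *m v) 0 0.

Record is_norm nrm : Prop := IsNorm {
  norm_triangle : forall u v, nrm (u + v) <= nrm u + nrm v;
  norm_homog : forall (c : R) u, nrm (c *: u) = `|c| * nrm u;
  norm_definite : forall u, nrm u = 0 -> u = 0 }.

Definition dual_norm nrm u : R :=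
  sup [set dot u v | v in [set v | nrm v <= 1]].

End vectors.

(* R^K as a measurable space: the Borel sets of the usual topology. *)
Notation borelRn R K := (g_sigma_algebraType (@open 'cV[R]_K)).

Section empirical.
Local Open Scope ereal_scope.
Context {R : realType} {K N : nat}.
Variables (N_gt0 : (0 < N)%N) (xi : 'I_N -> 'cV[R]_K).

(* [N_gt0] is unused in the body; it only makes the instance below
   a probability. *)
Definition empirical of (0 < N)%N := fun A : set (borelRn R K) =>
  (\sum_(i < N) (N%:R^-1)%:E * \d_(xi i : borelRn R K) A) : \bar R.

Local Notation PN := (empirical N_gt0).

Let PN0 : PN set0 = 0.
Proof. by rewrite /empirical big1// => i _; rewrite measure0 mule0. Qed.

Let w_ge0 : (0 <= N%:R^-1 :> R)%R.
Proof. by rewrite invr_ge0. Qed.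

Let PN_ge0 A : 0 <= PN A.
Proof. by apply: sume_ge0 => i _; rewrite mule_ge0// lee_fin. Qed.

Let PN_sigma_additive : semi_sigma_additive PN.
Proof.
move=> F mF tF mUF; rewrite [X in _ --> X](_ : _ =
    lim ((fun n => \sum_(0 <= i < n) PN (F i)) @ \oo)).
  by apply: is_cvg_ereal_nneg_natsum => k _; exact: PN_ge0.
rewrite nneseries_sum//; last by move=> i j _; rewrite mule_ge0// lee_fin.
apply: eq_bigr => /= i _.
exact: (@measure_semi_bigcup _ R _
  (mscale (NngNum w_ge0) \d_(xi i : borelRn R K)) F).
Qed.

HB.instance Definition _ := isMeasure.Build _ _ _ PN
  PN0 PN_ge0 PN_sigma_additive.

Let PNT : PN setT = 1.
Proof.
rewrite /empirical (eq_bigr (fun=> (N%:R^-1)%:E)) => [|i _]; last first.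
  by rewrite diracT mule1.
rewrite sumEFin sumr_const card_ord -[X in (X)%:E]mulr_natr mulVf//.
by rewrite pnatr_eq0 -lt0n.
Qed.

HB.instance Definition _ := Measure_isProbability.Build _ _ _ PN PNT.

End empirical.

Section wasserstein.
Local Open Scope ereal_scope.
Context {R : realType} {K : nat}.
Variable nrm : 'cV[R]_K -> R.

(* Measures are total functions on sets, arbitrary outside the sigma-algebra:
   marginals are compared on measurable sets only. *)
Definition is_coupling (mu nu : probability (borelRn R K) R)
    (pi : probability (borelRn R K * borelRn R K)%type R) : Prop :=
  forall A : set (borelRn R K), measurable A ->
    pushforward pi fst A = mu A /\ pushforward pi snd A = nu A.

Definition wasserstein (mu nu : probability (borelRn R K) R) : \bar R :=
  ereal_inf [set \int[pi]_w (nrm ((w.1 : 'cV[R]_K) - w.2)%R)%:E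
            | pi in is_coupling mu nu].

Definition ambiguity_set {N : nat} (N_gt0 : (0 < N)%N)
    (xi : 'I_N -> 'cV[R]_K) (theta : R) : set (probability (borelRn R K) R) :=
  [set mu | wasserstein (empirical xi N_gt0) mu <= theta%:E].

End wasserstein.

Section program.
Context {R : realType} {K L N P : nat}.
Variables (X : set 'cV[R]_L) (nrm : 'cV[R]_K -> R) (N_gt0 : (0 < N)%N)
  (xi : 'I_N -> 'cV[R]_K) (eps theta : R)
  (a : 'I_P -> 'cV[R]_L) (b : 'I_P -> 'cV[R]_K) (d : 'I_P -> R).

Definition safety_set (x : 'cV[R]_L) : set (borelRn R K) :=
  [set v | forall p, 0 < dot (b p) v + d p - dot (a p) x].

Definition X_DR : set 'cV[R]_L :=
  [set x | X x /\
    (ereal_sup [set mu (~` safety_set x) |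
       mu in ambiguity_set nrm N_gt0 xi theta] <= eps%:E)%E].

Definition sufficiently_large (M : R) : Prop :=
  0 < M /\ forall x i p, X x ->
    `|dot (b p) (xi i) + d p - dot (a p) x| / dual_norm nrm (b p) <= M.

(* [Num.truncn] is the floor on nonnegative reals. *)
Definition kfloor : nat := Num.truncn (eps * N%:R).

(* Positions in the decreasing list are counted from 0, so the entry of
   index k is the (k+1)-th largest. *)
Definition quantile (p : 'I_P) : R :=
  nth 0 (sort >=%R [seq - dot (b p) (xi i) | i <- enum 'I_N]) kfloor.

Record mip_feasible (M : R) (z : 'I_N -> bool) (r : 'I_N -> R) (t : R)
    (x : 'cV[R]_L) : Prop := MipFeasible {
  mip_t_ge0 : 0 <= t;
  mip_r_ge0 : forall i, 0 <= r i;
  mip_x_dom : X x;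
  mip_radius : eps * t >= theta + N%:R^-1 * \sum_(i < N) r i;
  mip_big_M : forall i, M * (1 - (z i)%:R) >= t - r i;
  mip_card : (\sum_(i < N) z i <= kfloor)%N;
  mip_dist : forall p i, quantile p < - dot (b p) (xi i) ->
    (dot (b p) (xi i) + d p - dot (a p) x) / dual_norm nrm (b p)
    + (- dot (b p) (xi i) - quantile p) / dual_norm nrm (b p) * (z i)%:R
    >= t - r i;
  mip_quantile : forall p,
    (- quantile p + d p - dot (a p) x) / dual_norm nrm (b p) >= t }.

End program.

(* Main.v *)
From HB Require Import structures.
Require Import Defs.
From mathcomp Require Import all_boot all_order all_algebra.
From mathcomp Require Import all_classical all_reals all_analysis.
From mathcomp Require Import measurable_realfun lra ring.

Set Implicit Arguments.
Unset Strict Implicit.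
Unset Printing Implicit Defensive.

Import Order.TTheory GRing.Theory Num.Theory.
Import numFieldNormedType.Exports.
Import HBNNSimple.

Local Open Scope classical_set_scope.
Local Open Scope ring_scope.

(* Let D_i be the distance of xi_i to the complement of the safety set, which is
   max(0, min_p (b_p xi_i + d_p - a_p x) / |b_p|_* ).  If r_i >= t - D_i, then
   integrating  min(t, D(v)) <= |v - v'| + t 1_safe(v')  over a coupling gives
   t P(unsafe) <= theta + avg r  for every P in the ambiguity set.  Conversely,
   take for t the (k+1)-th smallest D_i and r_i = max(0, t - D_i): were eps t
   smaller than theta + avg r, moving the samples of smallest D_i, the last ones
   fractionally, to (almost) nearest unsafe points would bring a mass larger
   than eps into the unsafe set at cost at most theta.  For this t one can take
   z_i = [D_i = 0], and at most k of the p-th slacks are below t, which is the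
   quantile constraint. *)

(** * Norms and dual norms on column vectors *)

Section dual_norms.
Context {R : realType} {K : nat}.
Implicit Types (u v b : 'cV[R]_K).

Lemma dotE u v : dot u v = \sum_i u i 0 * v i 0.
Proof. by rewrite /dot mxE; apply: eq_bigr => i _; rewrite mxE. Qed.

Lemma dotDr b u v : dot b (u + v) = dot b u + dot b v.
Proof. by rewrite /dot mulmxDr mxE. Qed.

Lemma dotZr b (c : R) v : dot b (c *: v) = c * dot b v.
Proof. by rewrite /dot -scalemxAr mxE. Qed.

Lemma dotBr b u v : dot b (u - v) = dot b u - dot b v.
Proof. by rewrite -scaleN1r dotDr dotZr mulN1r. Qed.

Lemma coord_le_mx_norm m n (A : 'M[R]_(m, n)) i j : `|A i j| <= `|A|.
Proof.
rewrite [leRHS]/Num.norm /= mx_normrE.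
exact: (le_bigmax _ (fun ij : 'I_m * 'I_n => `|A ij.1 ij.2|) (i, j)).
Qed.

Lemma mx_norm_tr m n (A : 'M[R]_(m, n)) : `|A^T| <= `|A|.
Proof.
rewrite [leLHS]/Num.norm /= mx_normrE; apply/bigmax_leP; split => // -[i j] _ /=.
by rewrite mxE coord_le_mx_norm.
Qed.

Lemma dot_continuous b : continuous (dot b).
Proof.
rewrite (_ : dot b = fun v => \sum_i b i 0 * v i 0); last first.
  by apply/funext => w; exact: dotE.
apply: continuous_big.
  exact: (@pseudometric_normed_Zmodule.add_continuous _ R).
move=> i _ v; exact: (cvgM (cvg_cst (b i 0)) (@coord_continuous _ _ _ i 0 v)).
Qed.

Variable nrm : 'cV[R]_K -> R.
Hypothesis nrm_norm : is_norm nrm.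

Lemma nrm0 : nrm 0 = 0.
Proof. by rewrite -(scale0r 0) norm_homog// normr0 mul0r. Qed.

Lemma nrmN v : nrm (- v) = nrm v.
Proof. by rewrite -scaleN1r norm_homog// normrN1 mul1r. Qed.

Lemma nrm_ge0 v : 0 <= nrm v.
Proof.
have := norm_triangle nrm_norm v (- v).
by rewrite subrr nrm0 nrmN; lra.
Qed.

Lemma nrm_gt0 v : v != 0 -> 0 < nrm v.
Proof.
move=> v0; rewrite lt_def nrm_ge0 andbT.
by apply: contra_neq v0; exact: norm_definite.
Qed.

Lemma nrm_sum (I : finType) (F : I -> 'cV[R]_K) :
  nrm (\sum_i F i) <= \sum_i nrm (F i).
Proof.
elim/big_ind2 : _ => //; first by rewrite nrm0.
by move=> u a v c ua vc; rewrite (le_trans (norm_triangle nrm_norm _ _))// lerD.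
Qed.

Lemma nrm_le_mx_norm : exists2 C : R, 0 <= C & forall v, nrm v <= C * `|v|.
Proof.
exists (\sum_i nrm (delta_mx i 0)); first by apply: sumr_ge0 => *; exact: nrm_ge0.
move=> v; rewrite mulr_suml [v in leLHS]matrix_sum_delta.
apply: (le_trans (nrm_sum _)); apply: ler_sum => i _.
rewrite big_ord1 norm_homog// mulrC ler_wpM2l ?nrm_ge0//.
exact: coord_le_mx_norm.
Qed.

(** The triangle inequality makes the norm Lipschitz for the max norm. Row vectors appear because
    the extreme value theorem applied below concerns them. *)
Lemma nrm_tr_continuous : continuous (fun v : 'rV[R]_K => nrm v^T).
Proof.
have [C C0 nrmC] := nrm_le_mx_norm.
have {}nrmC w w' : nrm w^T - nrm w'^T <= C * `|w - w'|.
  rewrite lerBlDl -{1}(subrK w' w) addrC linearD/=.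
  rewrite (le_trans (norm_triangle nrm_norm _ _))// lerD2l.
  by rewrite (le_trans (nrmC _))// ler_wpM2l// mx_norm_tr.
move=> v; apply/(cvgrPdist_le (FF := nbhs_filter v)) => e e0.
have C1 : 0 < C + 1 by rewrite ltr_wpDl.
have := @cvgr_dist_lt _ _ _ _ (nbhs_filter v) id v cvg_id _ (divr_gt0 e0 C1).
apply: filterS => u /=; rewrite ltr_pdivlMr// => vu.
have Ce : C * `|v - u| <= e by have := normr_ge0 (v - u); nra.
by rewrite ler_norml lerNl opprB !(le_trans (nrmC _ _))// distrC.
Qed.

(** Half of the equivalence of norms: by compactness [nrm] attains its minimum on the unit sphere of
    the max norm, and definiteness makes this minimum positive. The sphere is empty if there is no
    nonzero vector, hence the separate case. *)
Lemma mx_norm_le_nrm : exists2 C : R, 0 <= C & forall v, `|v| <= C * nrm v.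
Proof.
pose S := [set u : 'rV[R]_K | `|u| = 1].
have [[v0 v00]|all0] := pselect (exists v : 'rV[R]_K, v != 0); last first.
  exists 0 => // v; rewrite mul0r (_ : v = 0) ?normr0//.
  apply: trmx_inj; rewrite trmx0.
  by apply: contrapT => /eqP vT; apply: all0; exists v^T.
have S0 : S !=set0.
  exists (`|v0|^-1 *: v0); rewrite /S/= normrZ normfV normr_id mulVf//.
  by rewrite normr_eq0.
have cS : compact S.
  apply: bounded_closed_compact; first by exists 1; split => // x x1 y /= ->; exact: ltW.
  rewrite (_ : S = (fun u : 'rV[R]_K => `|u|) @^-1` [set 1])//.
  by apply: closed_comp => // x _; exact: norm_continuous.
have [u /= uS umin] := EVT_min_rV S0 cS (continuous_subspaceT nrm_tr_continuous).
rewrite inE in uS.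
have u0 : 0 < nrm u^T.
  apply: nrm_gt0; apply/negP => /eqP uT.
  have : u = 0 by rewrite -[u]trmxK uT trmx0.
  by move=> u0; move: uS; rewrite /S/= u0 normr0 => /esym/eqP; rewrite oner_eq0.
exists (nrm u^T)^-1; first by rewrite invr_ge0 ltW.
move=> v; have [->|v0'] := eqVneq v 0; first by rewrite normr0 nrm0 mulr0.
have vT0 : v^T != 0 by apply: contra_neq v0' => h; rewrite -[v]trmxK h trmx0.
have nv0 : 0 < `|v^T| by rewrite normr_gt0.
have := umin (`|v^T|^-1 *: v^T); rewrite inE => /(_ _).
rewrite linearZ/= trmxK norm_homog// normfV normr_id.
have vS : S (`|v^T|^-1 *: v^T).
  by rewrite /S/= normrZ normfV normr_id mulVf ?gt_eqF.
move=> /(_ vS).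
rewrite ler_pdivlMl// => h.
rewrite ler_pdivlMl// mulrC (le_trans _ h)// ler_wpM2r ?(ltW u0)//.
by have := mx_norm_tr v^T; rewrite trmxK.
Qed.

(** Equivalence of norms bounds the unit ball of [nrm], so that [dual_norm] is a genuine supremum
    and not the default value of [sup]. *)
Lemma has_sup_dual_norm b : has_sup [set dot b v | v in [set v | nrm v <= 1]].
Proof.
split; first by exists (dot b 0), 0 => //=; rewrite nrm0.
have [C C0 vC] := mx_norm_le_nrm.
exists (\sum_i `|b i 0| * C) => _ [v /= v1 <-].
rewrite dotE; apply: ler_sum => i _; apply: (le_trans (ler_norm _)).
rewrite normrM ler_wpM2l// (le_trans (coord_le_mx_norm _ _ _))//.
by rewrite (le_trans (vC _))// ler_piMr.
Qed.

Lemma dot_le_dual_norm b v : dot b v <= dual_norm nrm b * nrm v.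
Proof.
have [->|v0] := eqVneq v 0; first by rewrite nrm0 mulr0 dotE big1// => i; rewrite mxE mulr0.
rewrite -ler_pdivrMr ?nrm_gt0// mulrC -dotZr.
apply: ub_le_sup; first by have [] := has_sup_dual_norm b.
exists ((nrm v)^-1 *: v) => //=.
by rewrite norm_homog// ger0_norm ?invr_ge0 ?nrm_ge0// mulVf// gt_eqF// nrm_gt0.
Qed.

Lemma dual_norm_gt0 b : b != 0 -> 0 < dual_norm nrm b.
Proof.
move=> b0; have : 0 < dual_norm nrm b * nrm b.
  apply: (lt_le_trans _ (dot_le_dual_norm b b)).
  have /cV0Pn[i bi] := b0; rewrite dotE (bigD1 i)//= ltr_pwDl//.
    by rewrite -expr2 exprn_even_gt0.
  by apply: sumr_ge0 => j _; rewrite -expr2 sqr_ge0.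
by rewrite pmulr_lgt0// nrm_gt0.
Qed.

(** The factor [c] replaces attainment of the supremum; it reappears as a factor on the transport
    cost. *)
Lemma dual_norm_adherent b (c : R) : b != 0 -> 1 < c ->
  exists2 v, nrm v <= 1 & dual_norm nrm b < c * dot b v.
Proof.
move=> b0 c1; have c0 : 0 < c by apply: lt_trans c1.
have D0 := dual_norm_gt0 b0.
have e0 : 0 < dual_norm nrm b - c^-1 * dual_norm nrm b.
  by rewrite subr_gt0 gtr_pMl// invf_lt1.
have [_ [v /= v1 <-]] := sup_adherent e0 (has_sup_dual_norm b).
by rewrite -/(dual_norm nrm b) subKr ltr_pdivrMl// => h; exists v.
Qed.

End dual_norms.

(** * Order statistics and finitely supported measures *)

(** The body of [quantile] for an arbitrary family, so that it can also be applied to negated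
    distances. *)
Definition kth_largest (R : realDomainType) (N : nat) (F : 'I_N -> R) (k : nat) : R :=
  nth 0 (sort >=%R [seq F i | i <- enum 'I_N]) k.

(** In the decreasing list, the entries from position [k] on are at most [q] and the first [k + 1]
    are at least [q]. The bound [k < N] keeps [nth] away from its default value. *)
Lemma kth_largest_card (R : realDomainType) (N : nat) (F : 'I_N -> R) (k : nat)
    (q := kth_largest F k) : (k < N)%N ->
  (#|[pred i | (q < F i)%R]| <= k)%N /\ (k < #|[pred i | (q <= F i)%R]|)%N.
Proof.
move=> kN; rewrite {}/q /kth_largest; set s := sort _ _; set q := nth 0 s k.
have sz : size s = N by rewrite size_sort size_map size_enum_ord.
have s_nth i j : (i <= j < N)%N -> nth 0 s j <= nth 0 s i.
  move=> /andP[ij jN].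
  apply: (@sorted_leq_nth _ (>=%R : rel R)) => //; rewrite ?inE ?sz//.
  - by move=> x y z /= xy yz; exact: le_trans yz xy.
  - by move=> x /=.
  - by apply: sort_sorted => x y; exact: le_total.
  - exact: leq_ltn_trans ij jN.
have card_count (P : pred R) : #|[pred i | P (F i)]| = count P s.
  by rewrite count_sort count_map enumT cardE /enum_mem size_filter.
split.
- rewrite (card_count (fun y => q < y)) -(cat_take_drop k s) count_cat.
  rewrite (_ : count _ (drop k s) = 0%N) ?addn0.
    by rewrite (leq_trans (count_size _ _))// size_take sz kN.
  apply/eqP; rewrite -leqn0 leqNgt -has_count -all_predC.
  apply/(all_nthP 0) => i; rewrite size_drop sz ltn_subRL => iN /=.
  by rewrite nth_drop -leNgt s_nth// leq_addr.
- rewrite (card_count (fun y => q <= y)) -(cat_take_drop k.+1 s) count_cat.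
  rewrite (_ : count _ (take _ _) = k.+1) ?leq_addr//.
  have szt : size (take k.+1 s) = k.+1 by rewrite size_takel// sz.
  rewrite -[RHS]szt; apply/eqP; rewrite -all_count.
  apply/(all_nthP 0) => i; rewrite szt => ik.
  by rewrite nth_take// s_nth// -ltnS ik kN.
Qed.

Section discrete_measures.
Local Open Scope ereal_scope.
Context {d} {T : measurableType d} {R : realType} {I : finType}.
Variables (w : I -> {nonneg R}) (y : I -> T).

(** [msum] sums a sequence indexed by [nat], so [I] is enumerated by ordinals and the sequence is
    continued by the zero measure. *)
Definition discrete_summand (n : nat) : {measure set T -> \bar R} :=
  if insub n is Some j then mscale (w (enum_val (j : 'I_#|I|))) \d_(y (enum_val j))
  else mzero.

Lemma discrete_msumE (A : set T) :
  msum discrete_summand #|I| A = \sum_i (w i)%:num%:E * \d_(y i) A.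
Proof.
rewrite /msum/= [RHS]big_enum_val/=; apply: eq_bigr => j _.
by rewrite /discrete_summand valK.
Qed.

Lemma integral_discrete (mu : {measure set T -> \bar R}) (f : T -> \bar R) :
  (forall A, measurable A -> mu A = \sum_i (w i)%:num%:E * \d_(y i) A) ->
  (forall x, 0 <= f x) -> measurable_fun setT f ->
  \int[mu]_x f x = \sum_i (w i)%:num%:E * f (y i).
Proof.
move=> muE f0 mf; rewrite (@eq_measure_integral _ _ _ _ (msum discrete_summand #|I|)).
  rewrite ge0_integral_measure_sum// [RHS]big_enum_val/=; apply: eq_bigr => j _.
  rewrite /discrete_summand valK ge0_integral_mscale//.
  by rewrite integral_dirac// diracT mul1e.
by move=> A mA _; rewrite muE//; exact: esym (discrete_msumE A).
Qed.

(* The integral of a nonnegative function is a supremum over simple functions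
   below it, so the upper bound needs no measurability of the integrand. *)
Lemma integral_discrete_le (mu : {measure set T -> \bar R}) (f : T -> \bar R) :
  (forall A, measurable A -> mu A = \sum_i (w i)%:num%:E * \d_(y i) A) ->
  (forall x, 0 <= f x) ->
  \int[mu]_x f x <= \sum_i (w i)%:num%:E * f (y i).
Proof.
move=> muE f0; rewrite ge0_integralTE//; apply: ge_ereal_sup => _ [h /= hf <-].
rewrite -integralT_nnsfun (integral_discrete muE).
- by apply: lee_sum => i _; rewrite lee_wpmul2l// lee_fin.
- by move=> x; rewrite lee_fin; exact: fun_ge0.
- exact/measurable_EFinP.
Qed.

Lemma discrete_probability : (\sum_i (w i)%:num)%R = 1%R ->
  exists mu : probability T R,
    forall A, mu A = \sum_i (w i)%:num%:E * \d_(y i) A.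
Proof.
move=> w1; pose m := msum discrete_summand #|I|.
have mT : m setT = 1.
  rewrite /m discrete_msumE; under eq_bigr do rewrite diracT mule1.
  by rewrite sumEFin w1.
pose H := Measure_isProbability.Build _ _ _ m mT.
pose mu : probability T R := HB.pack_for (probability T R) m H.
by exists mu => A; exact: discrete_msumE.
Qed.

End discrete_measures.

(** * The distance to a union of half-spaces *)

(** Simple functions below [f] are also below [g]. This serves to bound the transport cost from
    below without proving it measurable. *)
Lemma ge0_le_integral_nonmeasurable d (T : measurableType d) (R : realType)
    (mu : {measure set T -> \bar R}) (f g : T -> \bar R) :
  (forall x, 0 <= f x)%E -> (forall x, f x <= g x)%E ->
  (\int[mu]_x f x <= \int[mu]_x g x)%E.
Proof.
move=> f0 fg; have g0 x : (0 <= g x)%E by apply: le_trans (fg x).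
rewrite !ge0_integralTE//; apply: le_ereal_sup => _ [h /= hf <-].
by exists h => //= x; exact: le_trans (fg x).
Qed.

Section halfspaces.
Context {R : realType} {K P : nat}.
Variables (nrm : 'cV[R]_K -> R) (nrm_norm : is_norm nrm).
Variables (b : 'I_P -> 'cV[R]_K) (b_neq0 : forall p, b p != 0) (e : 'I_P -> R).
Variable p0 : 'I_P.
Implicit Types v : 'cV[R]_K.

(** The signed distance, in [nrm], from [v] to the hyperplane bounding the [p]-th half-space. *)
Definition slack p v : R := (dot (b p) v + e p) / dual_norm nrm (b p).

Definition unsafe : set (borelRn R K) :=
  [set v | exists p, dot (b p) v + e p <= 0].

(** The default [slack p0 v] is itself a term of the minimum, so it does not change the value.
    [unsafe_dist_le] and [unsafe_dist_adherent] together identify this formula as the distance to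
    [unsafe]. *)
Definition unsafe_dist v : R :=
  Num.max 0 (\big[Num.min/slack p0 v]_p slack p v).

Lemma unsafe_dist_ge0 v : 0 <= unsafe_dist v.
Proof. by rewrite /unsafe_dist le_max lexx. Qed.

Lemma le_unsafe_distP t v : 0 < t ->
  t <= unsafe_dist v <-> forall p, t <= slack p v.
Proof.
move=> t0; rewrite /unsafe_dist le_max leNgt t0/=; split.
  by move=> /bigmin_geP[_ tv] p; exact: tv.
by move=> tv; apply/bigmin_geP.
Qed.

Lemma unsafe_distE v : exists p, unsafe_dist v = Num.max 0 (slack p v).
Proof.
suff [p pE] : exists p, \big[Num.min/slack p0 v]_p slack p v = slack p v.
  by exists p; rewrite /unsafe_dist pE.
apply: (big_ind (fun y => exists p, y = slack p v)).
- by exists p0.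
- move=> _ _ [p ->] [p' ->].
  by case: (leP (slack p v) (slack p' v)) => _; [exists p|exists p'].
- by move=> p _; exists p.
Qed.

(** A positive [unsafe_dist] is at most every slack; the slack of the half-space violated by [v'] is
    bounded through the duality of [nrm] and [dual_norm]. *)
Lemma unsafe_dist_le v v' : unsafe v' -> unsafe_dist v <= nrm (v - v').
Proof.
move=> [p pv']; have [//|d0] := leP (unsafe_dist v) 0.
  by move=> h; exact: le_trans (nrm_ge0 nrm_norm _).
have /(_ p) := (le_unsafe_distP v d0).1 (lexx _).
move/le_trans; apply.
rewrite ler_pdivrMr ?dual_norm_gt0// mulrC.
apply: le_trans (dot_le_dual_norm nrm_norm _ _).
by rewrite dotBr; lra.
Qed.

(** For the [p] of least slack, move from [v] along an almost maximizing direction [u] of the dual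
    norm until the hyperplane is reached. *)
Lemma unsafe_dist_adherent v (c : R) : 1 < c ->
  exists2 v', unsafe v' & nrm (v - v') <= c * unsafe_dist v.
Proof.
move=> c1; have [p pE] := unsafe_distE v.
have D0 := dual_norm_gt0 nrm_norm (b_neq0 p).
have [s0|s0] := leP (slack p v) 0.
  exists v.
    by exists p; move: s0; rewrite pmulr_lle0 // invr_gt0.
  by rewrite subrr nrm0// mulr_ge0 ?unsafe_dist_ge0//; lra.
have h0 : 0 < dot (b p) v + e p by move: s0; rewrite pmulr_lgt0// invr_gt0.
have [u u1 Du] := dual_norm_adherent nrm_norm (b_neq0 p) c1.
have bu0 : 0 < dot (b p) u by rewrite -(@pmulr_rgt0 _ c); lra.
rewrite {}pE (max_r (ltW s0)).
exists (v - ((dot (b p) v + e p) / dot (b p) u) *: u).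
  by exists p; rewrite dotBr dotZr divfK ?gt_eqF//; lra.
rewrite opprB addrC subrK norm_homog// gtr0_norm ?divr_gt0//.
rewrite (@le_trans _ _ ((dot (b p) v + e p) / dot (b p) u))//.
  by rewrite ler_piMr// ltW// divr_gt0.
rewrite /slack mulrCA ler_wpM2l ?(ltW h0)// ler_pdivlMr// mulrC ler_pdivrMr//.
exact: ltW.
Qed.

Lemma measurable_dot (u : 'cV[R]_K) :
  measurable_fun [set: borelRn R K] (dot u : borelRn R K -> R).
Proof.
apply: (measurability _ (RGenOpens.measurableE R)) => _ [_ [x [y ->]] <-].
rewrite setTI; apply: sub_sigma_algebra.
by have /continuousP := @dot_continuous _ _ u; apply; exact: interval_open.
Qed.

Lemma measurable_unsafe_dist :
  measurable_fun [set: borelRn R K] (unsafe_dist : borelRn R K -> R).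
Proof.
have mslack p : measurable_fun [set: borelRn R K] (slack p : borelRn R K -> R).
  apply: measurable_funM => //; apply: measurable_funD => //.
  exact: measurable_dot.
apply: measurable_maxr => //.
elim: (index_enum _) => [|p s IH].
  by under eq_fun do rewrite big_nil; exact: mslack.
by under eq_fun do rewrite big_cons; apply: measurable_minr.
Qed.

Lemma measurable_unsafe : measurable unsafe.
Proof.
rewrite (_ : unsafe = \bigcup_(p in [set: 'I_P])
    ((fun v : borelRn R K => dot (b p) v + e p) @^-1` `]-oo, 0])).
  apply: fin_bigcup_measurable => // p _; rewrite -[X in measurable X]setTI.
  by apply: measurable_funD => //; exact: measurable_dot.
apply/seteqP; split => [v [p pv]|v [p _]].
  by exists p => //=; rewrite in_itv.
by rewrite /= in_itv/= => pv; exists p.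
Qed.

End halfspaces.

(** * Optimal transport bounds on the unsafe probability *)

Section duality.
Context {R : realType} {K N P : nat}.
Variables (nrm : 'cV[R]_K -> R) (nrm_norm : is_norm nrm).
Variables (b : 'I_P -> 'cV[R]_K) (b_neq0 : forall p, b p != 0) (e : 'I_P -> R).
Variable p0 : 'I_P.
Variables (N_gt0 : (0 < N)%N) (xi : 'I_N -> 'cV[R]_K).

Local Notation D := (unsafe_dist nrm b e p0).
Local Notation U := (unsafe b e).

Lemma integral_empirical (f : borelRn R K -> \bar R) :
  (forall v, 0 <= f v)%E -> measurable_fun setT f ->
  (\int[empirical xi N_gt0]_v f v = \sum_i (N%:R^-1)%:E * f (xi i))%E.
Proof.
move=> f0 mf; have N0 : 0 <= N%:R^-1 :> R by [].
by rewrite (@integral_discrete _ _ _ _ (fun=> NngNum N0)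
  (xi : 'I_N -> borelRn R K)).
Qed.

Lemma coupling_cost_ge (mu : probability (borelRn R K) R) pi (t : R) :
  is_coupling (empirical xi N_gt0) mu pi -> 0 <= t ->
  ((N%:R^-1 * \sum_i Num.min t (D (xi i)))%:E <=
   \int[pi]_w (nrm ((w.1 : 'cV[R]_K) - w.2)%R)%:E + t%:E * mu (~` U))%E.
Proof.
move=> cpl t0; have mU := measurable_unsafe b e.
have mUc : measurable (~` U) by exact: measurableC.
pose f v := Num.min t (D v); pose c (v : borelRn R K) := t * \1_(~` U) v.
have f0 v : 0 <= f v by rewrite /f le_min t0 unsafe_dist_ge0.
have c0 v : 0 <= c v by rewrite mulr_ge0.
have mf : measurable_fun [set: borelRn R K] (f : borelRn R K -> R).
  by apply: measurable_minr => //; exact: measurable_unsafe_dist.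
have mc : measurable_fun [set: borelRn R K] c by exact: measurable_funM.
have m1 : measurable_fun setT (fun w : borelRn R K * borelRn R K => f w.1).
  exact: (measurableT_comp mf).
have m2 : measurable_fun setT (fun w : borelRn R K * borelRn R K => c w.2).
  exact: (measurableT_comp mc).
have -> : (N%:R^-1 * \sum_i Num.min t (D (xi i)))%:E = (\int[pi]_w (f w.1)%:E)%E.
  transitivity (\int[empirical xi N_gt0]_v (f v)%:E)%E.
    rewrite integral_empirical//; last exact/measurable_EFinP.
    by rewrite mulr_sumr -sumEFin; apply: eq_bigr.
  rewrite -(@eq_measure_integral _ _ _ _ _ (pushforward pi fst)).
    rewrite ge0_integral_pushforward//; first exact/measurable_EFinP.
    by move=> v _; rewrite lee_fin.
  by move=> A mA _; have [] := cpl A mA.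
have -> : (t%:E * mu (~` U) = \int[pi]_w (c w.2)%:E)%E.
  have [_ <-] := cpl _ mUc.
  under eq_integral do rewrite EFinM.
  rewrite ge0_integralZl_EFin//; last first.
    apply/measurable_EFinP.
    have mI : measurable_fun [set: borelRn R K] (\1_(~` U) : borelRn R K -> R) by [].
    exact: (measurableT_comp mI).
  rewrite (_ : (fun w : borelRn R K * borelRn R K => _) =
      (fun w => (\1_(snd @^-1` (~` U)) w)%:E))//.
  rewrite integral_indic// ?setIT//.
  by rewrite -[X in measurable X]setTI; exact: measurable_snd.
have f_le (w : borelRn R K * borelRn R K) :
    f w.1 <= nrm ((w.1 : 'cV[R]_K) - w.2) + c w.2.
  rewrite /c indicE; have [|] := boolP (w.2 \in ~` U).
    rewrite mulr1 => _; rewrite (@le_trans _ _ t)//; first by rewrite /f ge_min lexx.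
    by rewrite lerDr nrm_ge0.
  rewrite mulr0 addr0 notin_setE => /contrapT wU.
  by rewrite /f ge_min (unsafe_dist_le nrm_norm) ?orbT.
(* Additivity of the integral is applied to measurable functions only, which excludes the cost
   itself. The measurable [g] is squeezed in: [f <= g + c] pointwise, and [g] lies below the
   cost. *)
pose g (w : borelRn R K * borelRn R K) := Num.max 0 (f w.1 - c w.2).
have g0 w : 0 <= g w by rewrite /g le_max lexx.
have mg : measurable_fun setT g.
  by apply: measurable_maxr => //; exact: measurable_funB.
apply: (@le_trans _ _ (\int[pi]_w ((g w)%:E + (c w.2)%:E))%E).
  apply: ge0_le_integral => //.
  - by move=> w _; rewrite lee_fin.
  - exact/measurable_EFinP.
  - by apply: emeasurable_funD; exact/measurable_EFinP.
  - by move=> w _; rewrite -EFinD lee_fin -lerBlDr /g le_max lexx orbT.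
rewrite ge0_integralD//; last 4 first.
- by move=> w _; rewrite lee_fin.
- exact/measurable_EFinP.
- by move=> w _; rewrite lee_fin.
- exact/measurable_EFinP.
rewrite leeD2r//; apply: ge0_le_integral_nonmeasurable => w; rewrite lee_fin//.
by rewrite /g ge_max (nrm_ge0 nrm_norm)/= lerBlDr.
Qed.

(** Every coupling, optimal or not, obeys the cost bound, so the bound passes to the infimum; the
    safe probability is then replaced by one minus [mu U]. *)
Lemma unsafe_prob_le (mu : probability (borelRn R K) R) (theta t : R)
    (r : 'I_N -> R) :
  ambiguity_set nrm N_gt0 xi theta mu -> 0 <= t -> (forall i, 0 <= r i) ->
  (forall i, t - r i <= D (xi i)) ->
  (t%:E * mu U <= (theta + N%:R^-1 * \sum_i r i)%:E)%E.
Proof.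
move=> Wmu t0 r0 rD; have mU := measurable_unsafe b e.
have mUfin : mu U \is a fin_num by exact: fin_num_measure.
set s := N%:R^-1 * \sum_i Num.min t (D (xi i)).
have s_ge : t - N%:R^-1 * \sum_i r i <= s.
  have NN : N%:R * N%:R^-1 = 1 :> R by rewrite mulfV// pnatr_eq0 -lt0n.
  rewrite [X in X - _](_ : t = N%:R^-1 * \sum_(i < N) t); last first.
    by rewrite sumr_const card_ord -[t *+ N]mulr_natl mulrA [_^-1 * _]mulrC NN mul1r.
  rewrite -mulrBr -sumrB /s ler_wpM2l// ler_sum// => i _.
  by rewrite le_min rD andbT gerBl.
have : (s%:E - t%:E * mu (~` U) <= theta%:E)%E.
  apply: le_trans Wmu; apply: le_ereal_inf_tmp => _ [pi /= cpl <-].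
  rewrite leeBlDr; first exact: coupling_cost_ge.
  by rewrite fin_numM// fin_num_measure//; exact: measurableC.
rewrite probability_setC// -(fineK mUfin) -(EFinB 1) -!EFinM -EFinB !lee_fin.
move: s_ge; rewrite mulrBr mulr1; lra.
Qed.

(** A fraction [w i] of the mass at sample [i] moves to an almost nearest unsafe point and the rest
    stays. The strict budget inequality pays for not reaching a nearest point. *)
Lemma transport_to_unsafe (theta : R) (w : 'I_N -> R) :
  0 < theta -> (forall i, 0 <= w i <= 1) ->
  \sum_i w i * D (xi i) < N%:R * theta ->
  exists2 mu, ambiguity_set nrm N_gt0 xi theta mu &
    ((N%:R^-1 * \sum_i w i)%:E <= mu U)%E.
Proof.
move=> theta0 w01 cost_lt; set S := \sum_i _ in cost_lt.
have w0 i : 0 <= w i by have /andP[] := w01 i.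
have S0 : 0 <= S by apply: sumr_ge0 => i _; rewrite mulr_ge0// unsafe_dist_ge0.
have N0 : 0 < N%:R :> R by rewrite ltr0n.
have NN : N%:R * N%:R^-1 = 1 :> R by rewrite mulfV// gt_eqF.
(* Any [c > 1] with [c * S <= N * theta] would do; the added ones keep the denominator positive even
   when [S = 0]. *)
pose c := (N%:R * theta + 1) / (S + 1).
have c1 : 1 < c by rewrite /c ltr_pdivlMr; lra.
have cS : c * S <= N%:R * theta.
  by rewrite /c mulrAC ler_pdivrMr; nra.
have /choice[y yP] : forall i, exists v', U v' /\ nrm (xi i - v') <= c * D (xi i).
  move=> i; have [v' ? ?] := unsafe_dist_adherent nrm_norm b_neq0 e p0 (xi i) c1.
  by exists v'.
(* Atoms are indexed by a sample and a boolean: [true] for the part that moves, [false] for the part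
   that stays. *)
have weight_ge0 (ij : 'I_N * bool) :
    0 <= N%:R^-1 * (if ij.2 then w ij.1 else 1 - w ij.1).
  have /andP[? ?] := w01 ij.1; apply: mulr_ge0; first by rewrite invr_ge0 ltW.
  by case: ij.2 => //; rewrite subr_ge0.
pose W ij := NngNum (weight_ge0 ij).
pose y' (ij : 'I_N * bool) : borelRn R K := if ij.2 then y ij.1 else xi ij.1.
have W1 : \sum_ij (W ij)%:num = 1.
  rewrite /= -(pair_big xpredT xpredT (fun i j => N%:R^-1 * (if j then w i else 1 - w i)))/=.
  under eq_bigr do rewrite big_bool/= -mulrDr subrKC mulr1.
  by rewrite sumr_const card_ord -[_ *+ N]mulr_natr mulrC.
have [mu muE] := discrete_probability y' W1.
have [pi piE] := discrete_probability (fun ij => (xi ij.1 : borelRn R K, y' ij)) W1.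
exists mu.
  apply: (@le_trans _ _ (\int[pi]_w (nrm ((w.1 : 'cV[R]_K) - w.2)%R)%:E)%E).
    apply: ereal_inf_lbound; exists pi => //= A mA; split.
      rewrite /pushforward piE -(pair_big xpredT xpredT (fun i j =>
         (N%:R^-1 * (if j then w i else 1 - w i))%:E * \d_(xi i : borelRn R K) A)%E)/=.
      rewrite /empirical; apply: eq_bigr => i _.
      rewrite big_bool/= -ge0_muleDl ?lee_fin ?(weight_ge0 (i, true)) ?(weight_ge0 (i, false))//.
      by rewrite -EFinD -mulrDr subrKC mulr1.
    by rewrite /pushforward piE muE.
  apply: (le_trans (integral_discrete_le (fun A _ => piE A) _)).
    by move=> v; rewrite lee_fin nrm_ge0.
  rewrite /= -(pair_big xpredT xpredT (fun i j =>
     (N%:R^-1 * (if j then w i else 1 - w i))%:E * (nrm (xi i - y' (i, j)))%:E)%E)/=.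
  under eq_bigr do rewrite big_bool/= /y'/= subrr nrm0// mule0 adde0 -EFinM.
  rewrite sumEFin lee_fin (@le_trans _ _ (N%:R^-1 * (c * S)))//.
    rewrite /S !mulr_sumr ler_sum// => i _.
    rewrite -mulrA ler_wpM2l ?invr_ge0 ?(ltW N0)// mulrCA ler_wpM2l//.
    by have [] := yP i.
  by rewrite ler_pdivrMl.
rewrite muE -(pair_big xpredT xpredT (fun i j =>
  (N%:R^-1 * (if j then w i else 1 - w i))%:E * \d_(y' (i, j)) U)%E)/=.
rewrite mulr_sumr -sumEFin; apply: lee_sum => i _; rewrite big_bool/=.
rewrite /y'/= diracE mem_set ?mule1; last by have [] := yP i.
by rewrite leeDl// mule_ge0// lee_fin (weight_ge0 (i, false)).
Qed.

End duality.

(** * The mixed-integer reformulation *)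

(* A fractional knapsack: items of cost below [t] are taken entirely, those of
   cost [t] in equal proportions. *)
Lemma fractional_knapsack (R : realFieldType) (N : nat) (D : 'I_N -> R)
    (m budget t : R) : 0 <= t ->
  (#|[pred i | (D i < t)%R]|)%:R <= m -> m < (#|[pred i | (D i <= t)%R]|)%:R ->
  m * t - \sum_i Num.max 0 (t - D i) < budget ->
  exists w : 'I_N -> R, [/\ forall i, 0 <= w i <= 1,
    \sum_i w i * D i < budget & m < \sum_i w i].
Proof.
move=> t0; set L := #|[pred i | D i < t]|; set B := #|[pred i | D i <= t]|.
move=> Lm mB; set S := \sum_i _ => lt_budget.
pose E : R := B%:R - L%:R; have E0 : 0 < E by rewrite /E; lra.
(* Filling up to mass exactly [m] costs [m * t - S], so [g] is the unspent budget. *)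
pose g := budget - (m * t - S).
have g0 : 0 < g by rewrite /g; lra.
(* The mass taken from the [E] items of cost exactly [t]: it exceeds the missing [m - L], by an
   excess whose cost is less than [g]. *)
pose y := Num.min E (m - L%:R + g / (t + 1)).
have y_gt : m - L%:R < y.
  rewrite lt_min; apply/andP; split; first by rewrite /E; lra.
  by rewrite ltrDl divr_gt0//; lra.
have yE : y <= E by rewrite ge_min lexx.
have yt : y * t < (m - L%:R) * t + g.
  apply: (@le_lt_trans _ _ ((m - L%:R + g / (t + 1)) * t)).
    by rewrite ler_wpM2r// ge_min lexx orbT.
  by rewrite mulrDl ltrD2l mulrAC ltr_pdivrMr; nra.
have cardE_sum (Q : pred 'I_N) : (#|Q|)%:R = \sum_i (Q i)%:R :> R.
  rewrite -sum1_card natr_sum big_mkcond; apply: eq_bigr => i _.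
  by rewrite unfold_in; case: (Q i).
pose w i : R := (D i < t)%R%:R + (y / E) * (D i == t)%:R.
have le_split i : (D i <= t)%R%:R = (D i < t)%R%:R + (D i == t)%:R :> R.
  by rewrite le_eqVlt; case: ltgtP => //= _; rewrite ?addr0 ?add0r.
have EE : E = \sum_i (D i == t)%:R.
  rewrite /E /B /L !cardE_sum -sumrB; apply: eq_bigr => i _ /=.
  by rewrite le_split addrC addKr.
have SE : S = L%:R * t - \sum_i (D i < t)%R%:R * D i.
  rewrite /S /L cardE_sum mulr_suml -sumrB; apply: eq_bigr => i _ /=.
  by have [Dt|Dt] := ltP (D i) t; rewrite ?mul1r ?mul0r ?subr0//;
    [apply/max_r|apply/max_l]; lra.
exists w; split.
- move=> i; have yE01 : 0 <= y / E <= 1.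
    by rewrite divr_ge0 ?ler_pdivrMr ?mul1r ?yE//=; lra.
  by rewrite /w; case: ltgtP => _; rewrite ?mulr0 ?mulr1 ?addr0 ?add0r//= ?lexx ?ler01.
- have -> : \sum_i w i * D i = \sum_i (D i < t)%R%:R * D i + y * t.
    have -> : y * t = \sum_i (y / E) * (D i == t)%:R * D i.
      under eq_bigr do rewrite -mulrA.
      rewrite -mulr_sumr (_ : \sum_i _ = E * t) ?mulrA ?divfK ?gt_eqF//.
      rewrite EE mulr_suml; apply: eq_bigr => i _.
      by case: eqP => [->|]; rewrite ?mul0r.
    by rewrite -big_split/=; apply: eq_bigr => i _; rewrite /w mulrDl.
  by move: yt; rewrite /g SE; lra.
- rewrite /w big_split/= -mulr_sumr -EE divfK ?gt_eqF//.
  by move: y_gt; rewrite {1}/L cardE_sum; lra.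
Qed.

Section reformulation.
Context {R : realType} {K L N P : nat}.
Variables (X : set 'cV[R]_L) (nrm : 'cV[R]_K -> R) (nrm_norm : is_norm nrm).
Variables (N_gt0 : (0 < N)%N) (P_gt0 : (0 < P)%N) (xi : 'I_N -> 'cV[R]_K).
Variables (eps theta : R) (eps_gt0 : 0 < eps) (eps_lt1 : eps < 1).
Variable theta_gt0 : 0 < theta.
Variables (a : 'I_P -> 'cV[R]_L) (b : 'I_P -> 'cV[R]_K).
Variables (b_neq0 : forall p, b p != 0) (d : 'I_P -> R) (M : R).
Hypothesis M_large : sufficiently_large X nrm xi a b d M.

Let p0 : 'I_P := Ordinal P_gt0.
Let offset x p := d p - dot (a p) x.
Let k := @kfloor R N eps.

Lemma safety_setC x : ~` safety_set a b d x = unsafe b (offset x).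
Proof.
apply/seteqP; split => v; rewrite /= /safety_set /unsafe /offset/=.
  by move=> /existsNP[p /negP]; rewrite -leNgt => ?; exists p; lra.
by move=> [p ?] /(_ p); lra.
Qed.

Let slackE x p v :
  slack nrm b (offset x) p v = (dot (b p) v + d p - dot (a p) x) / dual_norm nrm (b p).
Proof. by rewrite /slack /offset addrA. Qed.

Let dual_gt0 p : 0 < dual_norm nrm (b p).
Proof. exact: dual_norm_gt0. Qed.

Let NR_gt0 : 0 < N%:R :> R.
Proof. by rewrite ltr0n. Qed.

Let epsN_bounds : k%:R <= eps * N%:R < k.+1%:R.
Proof. by apply: truncn_itv; rewrite mulr_ge0// ltW. Qed.

Let k_lt : (k < N)%N.
Proof.
have /andP[kN _] := epsN_bounds.
by rewrite -(ltr_nat R) (le_lt_trans kN)// gtr_pMl.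
Qed.

Lemma mip_feasible_X_DR z r t x :
  mip_feasible X nrm xi eps theta a b d M z r t x ->
  X_DR X nrm N_gt0 xi eps theta a b d x.
Proof.
case=> t0 r0 xX radius bigM _ hdist hquant; split=> //.
have sum_r0 : 0 <= N%:R^-1 * \sum_i r i by rewrite mulr_ge0// sumr_ge0.
have {}t0 : 0 < t.
  by rewrite -(@pmulr_rgt0 _ eps)// (lt_le_trans _ radius)// ltr_wpDr.
(* If [t - r i > 0], the big-M constraint makes [z i] false; the slack is then bounded by the
   distance constraint when the sample exceeds the quantile, and by the quantile constraint
   otherwise. *)
have rD i : t - r i <= unsafe_dist nrm b (offset x) p0 (xi i).
  have [tr|tr] := leP (t - r i) 0; first exact: le_trans (unsafe_dist_ge0 _ _ _ _ _).
  have zi : z i = false.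
    by apply/negP => zi; have := bigM i; rewrite zi subrr mulr0; lra.
  apply/le_unsafe_distP => // p; rewrite slackE.
  have [q_lt|q_ge] := ltP (quantile xi eps b p) (- dot (b p) (xi i)).
    by have := hdist p i q_lt; rewrite zi mulr0 addr0.
  apply: (@le_trans _ _ t); first by have := r0 i; lra.
  apply: le_trans (hquant p) _; rewrite ler_pM2r ?invr_gt0//; lra.
apply: ge_ereal_sup => _ [mu /= Fmu <-]; rewrite safety_setC.
have := unsafe_prob_le nrm_norm b_neq0 Fmu (ltW t0) r0 rD.
have mUfin : mu (unsafe b (offset x)) \is a fin_num.
  by apply: fin_num_measure; exact: measurable_unsafe.
rewrite -(fineK mUfin) -EFinM !lee_fin => h.
by rewrite -(ler_pM2l t0) mulrC [t * eps]mulrC; lra.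
Qed.

Lemma X_DR_mip_feasible x : X_DR X nrm N_gt0 xi eps theta a b d x ->
  exists z r t, mip_feasible X nrm xi eps theta a b d M z r t x.
Proof.
move=> [xX]; rewrite safety_setC => sup_le.
pose D i := unsafe_dist nrm b (offset x) p0 (xi i).
have D0 i : 0 <= D i by exact: unsafe_dist_ge0.
(* The two negations turn the [k]-th entry of a decreasing list into the (k+1)-th smallest
   distance. *)
pose t := - kth_largest (fun i => - D i) k.
have [lt_t le_t] := kth_largest_card (fun i => - D i) k_lt.
have {}lt_t : (#|[pred i | (D i < t)%R]| <= k)%N.
  by rewrite (leq_trans _ lt_t)//; apply/eq_leq/eq_card => i; rewrite !inE ltrNr.
have {}le_t : (k < #|[pred i | (D i <= t)%R]|)%N.
  by rewrite (leq_trans le_t)//; apply/eq_leq/eq_card => i; rewrite !inE lerNr.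
have t0 : 0 <= t.
  have /card_gt0P[i] : (0 < #|[pred i | (D i <= t)%R]|)%N by exact: leq_ltn_trans le_t.
  by rewrite inE; exact: le_trans.
have /andP[kN Nk] := epsN_bounds.
pose r i := Num.max 0 (t - D i).
have radius : theta + N%:R^-1 * \sum_i r i <= eps * t.
  (* The knapsack is filled beyond mass [eps * N], which lies between the two counts at [t] since
     [k <= eps * N < k + 1]. *)
  rewrite leNgt; apply/negP => lt_radius.
  have lt_budget : eps * N%:R * t - \sum_i r i < N%:R * theta.
    rewrite ltrBlDr -(ltr_pM2l (_ : 0 < N%:R^-1)) ?invr_gt0//.
    rewrite mulrDr mulKf ?gt_eqF// mulrAC [_ * N%:R]mulrC mulKf ?gt_eqF//.
  have [] := fractional_knapsack t0 _ _ lt_budget.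
  - by rewrite (le_trans _ kN)// ler_nat.
  - by rewrite (lt_le_trans Nk)// ler_nat.
  move=> w [w01 cost mass].
  have [mu Fmu mass_le] := transport_to_unsafe nrm_norm b_neq0 N_gt0 theta_gt0 w01 cost.
  have : ((N%:R^-1 * \sum_i w i)%:E <= eps%:E)%E.
    apply: le_trans mass_le _; apply: le_trans sup_le.
    by apply: ereal_sup_ubound; exists mu.
  by rewrite lee_fin ler_pdivrMl// leNgt mulrC mass.
have {}t0 : 0 < t.
  rewrite -(@pmulr_rgt0 _ eps)// (lt_le_trans _ radius)// ltr_wpDr//.
  by rewrite mulr_ge0// sumr_ge0// => i _; rewrite le_max lexx.
have D_slack i p : 0 < D i -> D i <= slack nrm b (offset x) p (xi i).
  by move=> Di0; exact: ((le_unsafe_distP _ _ _ p0 _ Di0).1 (lexx _)).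
have quant p : t <= (- quantile xi eps b p + d p - dot (a p) x) / dual_norm nrm (b p).
  have [_ q_card] := kth_largest_card (fun i => - dot (b p) (xi i)) k_lt.
  (* Pigeonhole: more than [k] samples reach the quantile and at most [k] have distance below
     [t]. *)
  have /existsP[i /andP[qi ti]] : [exists i : 'I_N,
      (quantile xi eps b p <= - dot (b p) (xi i)) && (t <= D i)].
    apply: contraLR lt_t => /existsPn no_i; rewrite -ltnNge.
    rewrite (leq_trans q_card)//; apply/subset_leq_card/fintype.subsetP => i; rewrite !inE => qi.
    by have := no_i i; rewrite qi/= -ltNge.
  apply: (le_trans ti); rewrite (le_trans (D_slack i p _)) ?(lt_le_trans t0)//.
  by rewrite slackE ler_pM2r ?invr_gt0//; lra.
(* A marked sample has [r i = t], so [t - r i] vanishes, and [t > 0] puts it among the at most [k]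
   samples of distance below [t]. For an unmarked one, [t - r i <= D i], which is at most every
   slack. *)
exists (fun i => D i == 0), r, t; split => //.
- exact: ltW.
- by move=> i; rewrite le_max lexx.
- move=> i; rewrite /r; have [Di|Di] := eqVneq (D i) 0.
    by rewrite Di subr0 subrr mulr0 max_r ?subrr ?(ltW t0).
  have Di0 : 0 < D i by rewrite lt_def Di D0.
  rewrite subr0 mulr1 (@le_trans _ _ (D i))//.
    by rewrite lerBlDr addrC -lerBlDr le_max lexx orbT.
  apply: (le_trans (D_slack i p0 Di0)); have [_ /(_ x i p0 xX)] := M_large.
  by apply: le_trans; rewrite slackE ler_pM2r ?invr_gt0// ler_norm.
- rewrite (leq_trans _ lt_t)// -sum1_card [leqRHS]big_mkcond/= leq_sum// => i _.
  by rewrite inE; case: eqP => // ->; rewrite t0.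
- move=> p i q_lt; rewrite /r; have [Di|Di] := eqVneq (D i) 0.
    (* With [z i = 1] the terms in [xi i] cancel and leave the left-hand side of the quantile
       constraint, which is at least [t]. *)
    rewrite Di subr0 max_r ?(ltW t0)// subrr mulr1 -mulrDl.
    rewrite (le_trans (ltW t0))// (le_trans (quant p))// ler_pM2r ?invr_gt0//; lra.
  have Di0 : 0 < D i by rewrite lt_def Di D0.
  rewrite mulr0 addr0 -slackE (le_trans _ (D_slack i p Di0))//.
  by rewrite lerBlDr addrC -lerBlDr le_max lexx orbT.
Qed.

End reformulation.

(** The optimal values are compared as infima in the extended reals, which covers an empty feasible
    region as well. *)
Theorem theorem3 (R : realType) (K L N P : nat)
    (K_gt0 : (0 < K)%N) (L_gt0 : (0 < L)%N) (N_gt0 : (0 < N)%N)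
    (P_gt0 : (0 < P)%N)
    (X : set 'cV[R]_L) (X_compact : compact X) (c : 'cV[R]_L)
    (nrm : 'cV[R]_K -> R) (nrm_norm : is_norm nrm)
    (xi : 'I_N -> 'cV[R]_K)
    (eps : R) (eps_gt0 : 0 < eps) (eps_lt1 : eps < 1)
    (theta : R) (theta_gt0 : 0 < theta)
    (a : 'I_P -> 'cV[R]_L) (b : 'I_P -> 'cV[R]_K)
    (b_neq0 : forall p, b p != 0) (d : 'I_P -> R)
    (M : R) (M_large : sufficiently_large X nrm xi a b d M) :
  X_DR X nrm N_gt0 xi eps theta a b d =
    [set x | X x /\ exists z r t,
       mip_feasible X nrm xi eps theta a b d M z r t x] /\
  ereal_inf [set (dot c x)%:E | x in X_DR X nrm N_gt0 xi eps theta a b d] =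
    ereal_inf [set v | exists z r t x,
       mip_feasible X nrm xi eps theta a b d M z r t x /\ v = (dot c x)%:E].
Proof.
have XE : X_DR X nrm N_gt0 xi eps theta a b d =
    [set x | X x /\ exists z r t,
       mip_feasible X nrm xi eps theta a b d M z r t x].
  apply/seteqP; split => x.
    by move=> xDR; split; [case: xDR|exact: X_DR_mip_feasible].
  by move=> [_ [z [r [t]]]]; exact: mip_feasible_X_DR.
split=> //; congr ereal_inf; apply/seteqP; split => v.
  by rewrite XE => -[x [_ [z [r [t feas]]]] <-]; exists z, r, t, x.
move=> [z [r [t [x [feas ->]]]]]; exists x => //.
exact: mip_feasible_X_DR feas.
Qed.
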